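(* Let $X$ be an $L$-Tychonoff space. If each pseudocompact subset of $X$ is contained in a Lindelöf subset of $X$, then $X$ is $Ps$-Tychonoff.
   Context: A topological space is pseudocompact if every real-valued continuous function on it is bounded; a subset is called pseudocompact (resp. Lindelöf) if it is so in the subspace topology. No separation axiom is assumed in pseudocompactness or in the Lindelöf property. Tychonoff means completely regular and $T_1$. A space $X$ is $L$-Tychonoff (resp. $Ps$-Tychonoff) if there exist a Tychonoff space $Y$ and a bijection $f:X\to Y$ such that $f|_K:K\to f(K)$ is a homeomorphism (subspace topologies) for every Lindelöf (resp. pseudocompact) subset $K$ of $X$. *)

(* Defs.v *)
From HB Require Import structures.
From mathcomp Require Import all_boot all_order all_algebra.
From mathcomp Require Import all_classical all_reals all_analysis.

Set Implicit Arguments.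
Unset Strict Implicit.
Unset Printing Implicit Defensive.

Import numFieldNormedType.Exports.

Local Open Scope classical_set_scope.

(* For K : set T, the coercion of K to the type [set_type K] carries the
   subspace topology (the initial topology of the inclusion), so a property of
   spaces is applied to a subset by writing it for K. *)

Definition pseudocompact_space (R : realType) (T : topologicalType) : Prop :=
  forall g : T -> R, continuous g -> bounded_fun g.

Definition lindelof_space (T : topologicalType) : Prop :=
  forall C : set (set T), (forall U, C U -> open U) ->
    [set: T] `<=` \bigcup_(U in C) U ->
  exists D : set (set T),
    [/\ D `<=` C, countable D & [set: T] `<=` \bigcup_(U in D) U].

Definition pseudocompact_set (R : realType) (T : topologicalType)
  (K : set T) : Prop := pseudocompact_space R K.

Definition lindelof_set (T : topologicalType) (K : set T) : Prop :=
  lindelof_space K.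

Definition homeomorphism (S T : topologicalType) (g : S -> T) : Prop :=
  continuous g /\
  exists h : T -> S, [/\ cancel g h, cancel h g & continuous h].

(* [completely_regular_space] is stated with uniform separators;
   [uniform_separatorP] turns it into separation of a point from a closed set
   by a continuous function into [0, 1]. *)
Definition tychonoff_space (T : topologicalType) : Prop :=
  completely_regular_space T /\ accessible_space T.

Definition restr_image (S T : Type) (f : S -> T) (K : set S) :
  K -> (f @` K) := sigLR [fun f in K].

Definition tychonoff_on (X : topologicalType) (P : set X -> Prop) : Prop :=
  exists (Y : topologicalType) (f : X -> Y),
    [/\ tychonoff_space Y, bijective f &
        forall K : set X, P K -> homeomorphism (@restr_image X Y f K)].

Definition L_tychonoff (X : topologicalType) : Prop :=
  tychonoff_on (@lindelof_set X).

Definition Ps_tychonoff (R : realType) (X : topologicalType) : Prop :=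
  tychonoff_on (@pseudocompact_set R X).

(* Main.v *)
(* A homeomorphism onto the image stays one on every smaller subset, so the
   bijection witnessing that X is L-Tychonoff also works for the pseudocompact
   subsets, each of which lies in a Lindelof one. *)

Require Import Defs.
From mathcomp Require Import all_boot all_order all_algebra.
From mathcomp Require Import all_classical all_reals all_analysis.

Local Open Scope classical_set_scope.

(** The universal property of the initial topology of the inclusion; it lets the arguments below
    forget the subset in the codomain. *)
Lemma continuous_set_val (S T : topologicalType) (A : set T) (g : S -> A) :
  continuous (set_val \o g) <-> continuous g.
Proof.
split=> [|cg x]; first exact: continuous_comp_initial.
by apply: continuous_comp; [exact: cg|exact: initial_continuous].
Qed.

Lemma subfun_continuous (T : topologicalType) (A B : set T) (sAB : A `<=` B) :
  continuous (subfun sAB).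
Proof. by apply/continuous_set_val; exact: initial_continuous. Qed.

(** The inverse for [K] is the inverse [h] for [L], cut down to the image of [K]. *)
Lemma homeomorphism_restr_imageS (S T : topologicalType) (f : S -> T)
    (K L : set S) :
  K `<=` L -> homeomorphism (@restr_image S T f L) ->
  homeomorphism (@restr_image S T f K).
Proof.
move=> sKL [cf [h [fK hK ch]]].
have sfKL : f @` K `<=` f @` L by exact: image_subset.
have restrE (x : K) :
    subfun sfKL (restr_image f x) = restr_image f (subfun sKL x).
  exact: val_inj.
(* A point of the image of [K] comes from some [x] in [K], and [fK] forces [h] to return that same
   [x]. *)
have hKP (y : f @` K) : val (h (subfun sfKL y)) \in K.
  have [x Kx fxy] := set_valP y.
  rewrite (_ : y = restr_image f (SigSub (mem_set Kx) : K)); last exact: val_inj.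
  by rewrite restrE fK /= inE.
have cvf : continuous (set_val \o @restr_image S T f L).
  exact/continuous_set_val.
have cvh : continuous (set_val \o h) by exact/continuous_set_val.
split.
  (* Seen in the ambient space, the map is by conversion the one for [L] precomposed with the
     inclusion of [K] into [L]; the inverse is treated alike. *)
  apply/continuous_set_val => x.
  exact: continuous_comp (subfun_continuous _ _ _ sKL x) (cvf _).
exists (fun y => SigSub (hKP y)); split.
- by move=> x; apply: val_inj; rewrite /= restrE fK.
- move=> y; apply: val_inj => /=.
  exact: (congr1 val (hK (subfun sfKL y))).
- apply/continuous_set_val => y.
  exact: continuous_comp (subfun_continuous _ _ _ sfKL y) (cvh _).
Qed.

Theorem theorem3p5 (R : realType) (X : topologicalType)
    (hL : L_tychonoff X)
    (hPs : forall K : set X, pseudocompact_set R K ->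
       exists L : set X, lindelof_set L /\ K `<=` L) :
  Ps_tychonoff R X.
Proof.
have [Y [f [tY bf fL]]] := hL; exists Y, f; split=> // K /hPs[L [LL sKL]].
exact: homeomorphism_restr_imageS sKL (fL L LL).
Qed.
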